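(* Let $G$ be a connected graph on $n$ vertices, and suppose that $\mathcal{S}$ is an equitable partition of $G$. Then for any $\alpha\in(0,\pi/2)$, $\mathcal{S}$ is an $\alpha$-Kuramoto partition of $G$.
   Context: Graphs are finite, without self-loops or multiple edges, with vertex set $V(G)=\{1,\ldots,n\}$ and adjacency matrix $A=A(G)$. A partition of $G$ is a division of $V(G)$ into disjoint, non-empty sets (called parts) that cover $V(G)$. Equitable partition: a partition $\mathcal{S}$ of $G$ with parts $S_1,\ldots,S_k$ is equitable if the number of neighbours in $S_j$ of a vertex $v\in S_i$ depends only on the choice of the parts $S_i$ and $S_j$ (for all $i,j$, including $i=j$). Frustrated Kuramoto model (with natural frequency $0$ and interaction strength $1$): for a phase frustration parameter $\alpha$, the system $$\theta_i'(t)=\sum_{j=1}^n A_{i,j}\sin(\theta_j(t)-\theta_i(t)-\alpha),\qquad t\ge 0,\quad i=1,\ldots,n,$$ for real-valued functions $\theta_1,\ldots,\theta_n$ on $[0,\infty)$. $\alpha$-Kuramoto partition: for fixed $\alpha\in(0,\pi/2)$, a partition $\mathcal{S}=S_1\cup S_2\cup\cdots\cup S_k$ of $G$ is an $\alpha$-Kuramoto partition if there is an initial condition $\theta_j(0)=x_j$ ($x_j\in\mathbb{R}$, $j=1,\ldots,n$) such that the solution of the frustrated Kuramoto model with this initial condition satisfies: (1) if $i,j\in S_l$ for some $l$, then $\theta_i(t)=\theta_j(t)$ for all $t\ge 0$; (2) if $i\in S_p$, $j\in S_q$ for distinct indices $p,q$, then $\theta_i\neq\theta_j$ as functions on $[0,\infty)$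 (i.e. they are not identically equal). *)

(* Defs.v *)
From mathcomp Require Import all_boot all_order all_algebra.
From mathcomp Require Import all_classical all_reals all_analysis.

Set Implicit Arguments.
Unset Strict Implicit.
Unset Printing Implicit Defensive.
Import Order.TTheory GRing.Theory Num.Theory.
Import numFieldNormedType.Exports.
Local Open Scope classical_set_scope.
Local Open Scope ring_scope.

(* A graph on n vertices is a symmetric irreflexive relation on 'I_n. *)
Definition simple_graph (n : nat) (e : rel 'I_n) : Prop :=
  symmetric e /\ irreflexive e.

Definition connected_graph (n : nat) (e : rel 'I_n) : Prop :=
  forall u v : 'I_n, connect e u v.

Definition adjacency (R : realType) (n : nat) (e : rel 'I_n) : 'M[R]_n :=
  \matrix_(i, j) (e i j)%:R.

Definition equitable_partition (n : nat) (e : rel 'I_n)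
    (S : {set {set 'I_n}}) : Prop :=
  finset.partition S [set: 'I_n]%SET /\
  forall P Q : {set 'I_n}, P \in S -> Q \in S ->
  forall u v : 'I_n, u \in P -> v \in P ->
    #|[set w in Q | e u w]%SET| = #|[set w in Q | e v w]%SET|.

(* Derivative of a function on [0, +oo[: difference quotients are taken only
   at points s >= 0, so this is the right derivative at t = 0 and the usual
   derivative at t > 0; the values of f at negative reals play no role. *)
Definition ray_derivative (R : realType) (f : R -> R) (t l : R) : Prop :=
  (f s - f t) / (s - t) @[s --> within [set s | 0 <= s] t^'] --> l.

Definition kuramoto_solution (R : realType) (n : nat) (e : rel 'I_n)
    (alpha : R) (x : 'I_n -> R) (theta : 'I_n -> R -> R) : Prop :=
  (forall i : 'I_n, theta i 0 = x i) /\
  forall (i : 'I_n) (t : R), 0 <= t ->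
    ray_derivative (theta i) t
      (\sum_(j < n) adjacency R e i j * sin (theta j t - theta i t - alpha)).

(* "The" solution with initial condition x: a solution exists, and the two
   conditions are required of every solution. *)
Definition kuramoto_partition (R : realType) (n : nat) (e : rel 'I_n)
    (alpha : R) (S : {set {set 'I_n}}) : Prop :=
  finset.partition S [set: 'I_n]%SET /\
  exists x : 'I_n -> R,
    (exists theta : 'I_n -> R -> R, kuramoto_solution e alpha x theta) /\
    forall theta : 'I_n -> R -> R, kuramoto_solution e alpha x theta ->
      (forall P : {set 'I_n}, P \in S ->
        forall i j : 'I_n, i \in P -> j \in P ->
        forall t : R, 0 <= t -> theta i t = theta j t) /\
      (forall P Q : {set 'I_n}, P \in S -> Q \in S -> P <> Q ->
        forall i j : 'I_n, i \in P -> j \in Q ->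
        ~ (forall t : R, 0 <= t -> theta i t = theta j t)).

(* Main.v *)
Require Import Defs.
From mathcomp Require Import all_boot all_order all_algebra.
From mathcomp Require Import all_classical all_reals all_analysis.
From mathcomp Require Import ring lra.

Set Implicit Arguments.
Unset Strict Implicit.
Unset Printing Implicit Defensive.
Import Order.TTheory GRing.Theory Num.Theory.
Import numFieldNormedType.Exports.
Local Open Scope classical_set_scope.
Local Open Scope ring_scope.

(** Give the vertices of each part one common initial phase, and different
    parts different phases.  Different parts are then already separated at time
    [0], so two facts about the flow remain: a solution starting at this point
    exists, and in every such solution the parts stay synchronised.

    Synchronisation rests on [kuramoto_field_equitable].  When the phases depend
    only on the part, the force on a vertex depends only on how many neighbours
    it has in each part, so by equitability it is the same throughout a part:
    the phases that are constant on the parts form an invariant subspace of the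
    vector field.  To see that no solution leaves this subspace, compare each
    phase with the phase of a representative of its part.  The differences
    vanish at [0] and, the field being Lipschitz in the sup norm, their
    derivatives are at most a constant times the largest of them; a Gronwall
    argument ([linear_bound_eq0]) shows that they vanish forever.

    Existence is the global Picard-Lindelof theorem for a Lipschitz autonomous
    system on [[0, +oo[] ([picard_lindelof]).

    Both arguments use the same contraction ([expR_weighted_bound]): if
    [h 0 = 0] and [|h'| <= c e^(2Lt)], then [|h| <= c / (2L) e^(2Lt)].  When
    [c = L d], as for a field with Lipschitz constant [L], this turns the bound
    [d e^(2Lt)] into its half.  Iteration gives a geometric decay, uniform on
    bounded intervals, with no restriction to short times. *)

(** * Derivatives on the half-line *)

(** Clearing the denominator makes the point [s = t] harmless, so that the
    punctured filter disappears; [is_deriveP] puts the two-sided derivative in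
    the same form, and the two notions become directly comparable. *)
Lemma ray_derivativeP (R : realType) (f : R -> R) (t l : R) :
  ray_derivative f t l <->
  forall eps, 0 < eps -> \forall s \near t,
    0 <= s -> `|f s - f t - l * (s - t)| <= eps * `|s - t|.
Proof.
split=> [/cvgrPdist_le fl eps eps0|fl].
  have := fl _ eps0; rewrite near_withinE near_withinE.
  apply: filterS => s /= H s0.
  have [->|st] := eqVneq s t; first by rewrite !subrr mulr0 subrr normr0 mulr0.
  have := H st s0; rewrite distrC.
  have st0 : s - t != 0 by rewrite subr_eq0.
  rewrite -(ler_pM2r (_ : 0 < `|s - t|)) ?normr_gt0//.
  by rewrite -normrM mulrBl divfK.
apply/cvgrPdist_le => eps eps0; rewrite near_withinE near_withinE.
apply: filterS (fl _ eps0) => s /= H st s0.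
have st0 : s - t != 0 by rewrite subr_eq0.
rewrite distrC -(ler_pM2r (_ : 0 < `|s - t|)) ?normr_gt0//.
by rewrite -normrM mulrBl divfK// H.
Qed.

Lemma is_deriveP (R : realType) (f : R -> R) (t l : R) :
  is_derive t 1 f l <->
  forall eps, 0 < eps -> \forall s \near t,
    `|f s - f t - l * (s - t)| <= eps * `|s - t|.
Proof.
have -> : is_derive t 1 f l <-> (h^-1 *: (f (h + t) - f t) @[h --> 0^'] --> l).
  rewrite (_ : (fun h => _) =
    fun h => h^-1 *: ((f \o shift t) (h *: 1) - f t)); last first.
    by apply/funext => h /=; rewrite [h *: _]mulr1.
  split=> [[df <-]|fl]; first exact: df.
  by split; [apply/cvg_ex; exists l|exact: cvg_lim fl].
split=> [/cvgrPdist_le fl eps eps0|fl].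
  have := fl _ eps0; rewrite near_withinE (near_shift (0 : R) t).
  apply: filterS => h /=; rewrite subr0 addrK => H.
  have [->|h0] := eqVneq h 0.
    by rewrite add0r !subrr mulr0 subrr normr0 mulr0.
  have := H h0; rewrite distrC.
  rewrite -(ler_pM2r (_ : 0 < `|h|)) ?normr_gt0//.
  by rewrite -normrM mulrBl [_ *: _]mulrC divfK.
apply/cvgrPdist_le => eps eps0; have := fl _ eps0.
rewrite near_withinE (near_shift (0 : R) t).
apply: filterS => h /=; rewrite subr0 addrK => H h0.
rewrite distrC -(ler_pM2r (_ : 0 < `|h|)) ?normr_gt0//.
by rewrite -normrM mulrBl [_ *: _]mulrC divfK.
Qed.

Lemma is_derive_ray (R : realType) (f : R -> R) (t l : R) :
  is_derive t 1 f l -> ray_derivative f t l.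
Proof.
move=> /is_deriveP fl; apply/ray_derivativeP => eps eps0.
by apply: filterS (fl _ eps0) => s H _.
Qed.

Lemma ray_is_derive (R : realType) (f : R -> R) (t l : R) :
  0 < t -> ray_derivative f t l -> is_derive t 1 f l.
Proof.
move=> t0 /ray_derivativeP fl; apply/is_deriveP => eps eps0.
apply: filterS2 (fl _ eps0) (lt_nbhsr t0) => s H s0.
exact/H/ltW.
Qed.

Lemma ray_derivative_ext (R : realType) (f g : R -> R) (t l : R) :
  (forall s, 0 <= s -> f s = g s) -> 0 <= t ->
  ray_derivative f t l -> ray_derivative g t l.
Proof.
move=> fg t0 /ray_derivativeP fl; apply/ray_derivativeP => eps eps0.
by apply: filterS (fl _ eps0) => s H s0; rewrite -!fg// H.
Qed.

Lemma ray_derivativeB (R : realType) (f g : R -> R) (t a b : R) :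
  ray_derivative f t a -> ray_derivative g t b ->
  ray_derivative (fun s => f s - g s) t (a - b).
Proof.
move=> fa gb; rewrite /ray_derivative.
under eq_fun do rewrite opprD addrACA -opprD mulrBl.
exact: cvgB.
Qed.

Lemma ray_derivativeN (R : realType) (f : R -> R) (t a : R) :
  ray_derivative f t a -> ray_derivative (fun s => - f s) t (- a).
Proof.
move=> fa; rewrite /ray_derivative.
under eq_fun do rewrite -opprD mulNr.
exact: cvgN.
Qed.

Lemma ray_derivative_within_continuous (R : realType) (f f' : R -> R) (t : R) :
  (forall s, 0 <= s -> ray_derivative f s (f' s)) ->
  {within `[0, t], continuous f}.
Proof.
move=> df; apply/subspace_continuousP => x /=; rewrite in_itv/= => /andP[x0 xt].
have /ray_derivativeP/(_ 1 ltr01) H := df x x0.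
apply/cvgrPdist_le => eps eps0; rewrite near_withinE.
pose K := 1 + `|f' x|.
have K0 : 0 < K by rewrite ltr_wpDr.
have e0 : 0 < eps / K by rewrite divr_gt0.
apply: filterS2 H (nbhsx_ballx x _ e0) => s H; rewrite /ball/= => xs.
rewrite in_itv/= => /andP[s0 _]; have {}H := H s0.
rewrite distrC -(subrK (f' x * (s - x)) (f s - f x)).
apply: (le_trans (ler_normD _ _)); rewrite normrM.
apply: (le_trans (lerD H (lexx _))); rewrite -mulrDl -/K.
by rewrite mulrC -ler_pdivlMr// distrC ltW.
Qed.

(** Differentiability inside [[0, t]] and continuity up to the end points are all
    that the mean value theorem asks for. *)
Lemma ray_nondecreasing (R : realType) (f f' : R -> R) :
  (forall s, 0 <= s -> ray_derivative f s (f' s)) ->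
  (forall s, 0 <= s -> 0 <= f' s) ->
  forall t, 0 <= t -> f 0 <= f t.
Proof.
move=> df f'0 t t0; have [->//|tn0] := eqVneq t 0.
have fd x : x \in `]0, t[ -> is_derive x 1 f (f' x).
  rewrite in_itv/= => /andP[x0 _]; apply: ray_is_derive => //; exact/df/ltW.
apply: (@ger0_derive1_le_cc _ f 0 t) => //.
- by move=> x /fd [].
- move=> x xt; rewrite derive1E; have [_ ->] := fd x xt.
  by apply: f'0; move: xt; rewrite in_itv/= => /andP[/ltW].
- exact: ray_derivative_within_continuous df.
- by rewrite in_itv/= lexx.
- by rewrite in_itv/= t0 lexx.
Qed.

Lemma ray_derivative_le (R : realType) (f f' g g' : R -> R) :
  (forall s, 0 <= s -> ray_derivative f s (f' s)) ->
  (forall s, 0 <= s -> ray_derivative g s (g' s)) ->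
  (forall s, 0 <= s -> f' s <= g' s) ->
  forall t, 0 <= t -> f t - f 0 <= g t - g 0.
Proof.
move=> df dg fg t t0.
have H := @ray_nondecreasing _ (fun s => g s - f s) (fun s => g' s - f' s).
have {}H : g 0 - f 0 <= g t - f t.
  apply: H => // s s0; last by rewrite subr_ge0 fg.
  by apply: ray_derivativeB; [exact: dg|exact: df].
lra.
Qed.

(** Integrating [c e^(at)] gains the factor [1 / a] and reproduces the weight
    [e^(at)].  With [a] twice the Lipschitz constant, this is the contraction
    behind both the uniqueness and the existence argument. *)
Lemma expR_weighted_bound (R : realType) (h h' : R -> R) (a c : R) : 0 < a ->
  h 0 = 0 ->
  (forall t, 0 <= t -> ray_derivative h t (h' t)) ->
  (forall t, 0 <= t -> `|h' t| <= c * expR (a * t)) ->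
  forall t, 0 <= t -> `|h t| <= c / a * expR (a * t).
Proof.
move=> a0 h0 dh bh t t0.
have c0 : 0 <= c.
  by have := bh 0 (lexx _); rewrite mulr0 expR0 mulr1; exact: le_trans.
pose k s := c / a * expR (a * s).
have dk s : 0 <= s -> ray_derivative k s (c * expR (a * s)).
  move=> s0; apply: is_derive_ray.
  have -> : c * expR (a * s) = c / a * (expR (a * s) * a).
    by field; rewrite gt_eqF.
  apply: is_deriveZ => //=.
  have := @is_derive1_comp _ expR (fun x => a * x) s (expR (a * s)) a.
  apply; apply: is_derive_eq; exact: mulr1.
have k0 : 0 <= k 0 by rewrite /k mulr0 expR0 mulr1 divr_ge0// ltW.
have dNh s : 0 <= s -> ray_derivative (fun s => - h s) s (- h' s).
  by move=> s0; exact/ray_derivativeN/dh.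
have hb s : 0 <= s -> h' s <= c * expR (a * s).
  by move=> s0; apply: le_trans (bh s s0); exact: ler_norm.
have Nhb s : 0 <= s -> - h' s <= c * expR (a * s).
  by move=> s0; apply: le_trans (bh s s0); rewrite -normrN; exact: ler_norm.
have := ray_derivative_le dh dk hb t0; have := ray_derivative_le dNh dk Nhb t0.
by rewrite h0 -/(k t) ler_norml => ? ?; lra.
Qed.

(** * Vanishing of solutions of linear differential inequalities *)

Lemma geometric_le0 (R : realType) (y c : R) :
  (forall k, y <= c * 2^-1 ^+ k) -> y <= 0.
Proof.
move=> yc; have half1 : `|2^-1 : R| < 1.
  by rewrite ger0_norm ?invr_ge0// invf_lt1 ?ltr1n.
have c0 := cvg_geometric c half1.
rewrite -(cvg_lim (@Rhausdorff R) c0); apply: limr_ge; last exact: nearW.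
exact: (cvgP _ c0).
Qed.

(** Gronwall's inequality for the sup norm of a family.  The bound [K] only
    starts the induction: it gives [|h_i t| <= K / (2L) e^(2Lt)], and each
    further pass through [expR_weighted_bound] halves the constant. *)
Lemma linear_bound_eq0 (R : realType) (I : Type) (h h' : I -> R -> R)
    (L K : R) :
  0 < L ->
  (forall i, h i 0 = 0) ->
  (forall i t, 0 <= t -> ray_derivative (h i) t (h' i t)) ->
  (forall i t, 0 <= t -> `|h' i t| <= K) ->
  (forall t d, 0 <= t -> (forall j, `|h j t| <= d) ->
     forall i, `|h' i t| <= L * d) ->
  forall i t, 0 <= t -> h i t = 0.
Proof.
move=> L0 h0 dh hK hL i t t0.
have L20 : 0 < 2 * L by rewrite mulr_gt0.
pose C := K / (2 * L).
have bound k : forall j s, 0 <= s ->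
    `|h j s| <= C * 2^-1 ^+ k * expR (2 * L * s).
  elim: k => [|k IH] j s s0.
    rewrite expr0 mulr1.
    apply: (expR_weighted_bound L20 (h0 j) (dh j)) => // r r0.
    have K0 : 0 <= K by apply: le_trans (hK j r r0).
    have e1 : 1 <= expR (2 * L * r).
      by rewrite -[leLHS]expR0 ler_expR mulr_ge0// ltW.
    by apply: (le_trans (hK j r r0)); rewrite -[leLHS]mulr1 ler_wpM2l.
  have -> : C * 2^-1 ^+ k.+1 = L * (C * 2^-1 ^+ k) / (2 * L).
    by rewrite exprS; field; rewrite gt_eqF.
  apply: (expR_weighted_bound L20 (h0 j) (dh j)) => // r r0.
  rewrite -mulrA; apply: hL => // m; exact: IH.
apply/eqP; rewrite -normr_le0.
apply: (@geometric_le0 _ _ (C * expR (2 * L * t))) => k.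
by rewrite mulrAC; exact: bound.
Qed.

(** * Primitives on the half-line *)

(** The lower end point [-1] makes [0] interior, so that the fundamental theorem
    of calculus applies at [0] as well.  The truncation [Num.max t 0] freezes the
    primitive at negative times: it becomes continuous on the whole line and can
    be fed back into the Picard iteration without restricting domains. *)
Definition ray_primitive (R : realType) (f : R -> R) (t : R) : R :=
  \int[lebesgue_measure]_(s in `[-1, Num.max t 0]) f s -
  \int[lebesgue_measure]_(s in `[-1, 0]) f s.

Section ray_primitive.
Variables (R : realType) (f : R -> R).
Hypothesis cf : continuous f.

Let F (t : R) := \int[lebesgue_measure]_(s in `[-1, t]) f s.

Let is_derive_F (t : R) : 0 <= t -> is_derive t 1 F (f t).
Proof.
move=> t0; have t1 : -1 < t by apply: lt_le_trans t0; rewrite ltrN10.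
have intf : lebesgue_measure.-integrable `[-1, t + 1] (EFin \o f).
  apply: continuous_compact_integrable; first exact: segment_compact.
  exact: continuous_subspaceT.
have ct : {for t, continuous f} by exact: cf.
have [dF <-] := continuous_FTC1_closed (ltr_pwDr ltr01 (lexx t)) intf t1 ct.
apply: DeriveDef; first exact: dF.
by rewrite derive1E.
Qed.

Lemma ray_primitive0 : ray_primitive f 0 = 0.
Proof. by rewrite /ray_primitive maxxx subrr. Qed.

Lemma ray_primitive_max (t : R) :
  ray_primitive f t = ray_primitive f (Num.max t 0).
Proof. by rewrite /ray_primitive -maxA maxxx. Qed.

Lemma ray_derivative_primitive (t : R) : 0 <= t ->
  ray_derivative (ray_primitive f) t (f t).
Proof.
move=> t0; apply: (@ray_derivative_ext _ (fun s => F s - F 0)) => //.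
  by move=> s s0; rewrite /ray_primitive (max_idPl s0).
apply: is_derive_ray; rewrite -[f t]subr0.
have dF := is_derive_F t0; exact: is_deriveB.
Qed.

Lemma continuous_ray_primitive : continuous (ray_primitive f).
Proof.
move=> t; have m0 : 0 <= Num.max t 0 by rewrite le_max lexx orbT.
have [dF _] := is_derive_F m0.
have cF : {for Num.max t 0, continuous F}.
  by apply: differentiable_continuous; apply/derivable1_diffP.
have cmax : {for t, continuous (fun s : R => Num.max s 0)}.
  by apply: (@continuous_max _ _ id (cst 0)); [exact: cvg_id|exact: cvg_cst].
have cFmax : F (Num.max s 0) @[s --> t] --> F (Num.max t 0).
  exact: (continuous_comp cmax cF).
exact: (cvgB cFmax (cvg_cst _)).
Qed.

End ray_primitive.

(** * Global existence for Lipschitz systems *)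

Definition sup_lipschitz (R : realType) (I : Type) (F : (I -> R) -> I -> R)
    (L : R) : Prop :=
  forall (u v : I -> R) (d : R), (forall j, `|u j - v j| <= d) ->
  forall i, `|F u i - F v i| <= L * d.

Section picard.
Variables (R : realType) (I : finType) (F : (I -> R) -> I -> R) (L : R).
Hypotheses (L0 : 0 < L) (FL : sup_lipschitz F L).
Variable x : I -> R.

Let L20 : 0 < 2 * L. Proof. by rewrite mulr_gt0. Qed.

(* The weight of the norm in which the Picard map halves distances; iterates are
   constant on negative times, and so is the weight. *)
Let w (t : R) : R := expR (2 * L * Num.max t 0).

Let continuous_field (u : I -> R -> R) :
  (forall j, continuous (u j)) -> forall i, continuous (fun s => F (u^~ s) i).
Proof.
move=> cu i t; apply/cvgrPdist_le => eps eps0.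
have e0 : 0 < eps / L by rewrite divr_gt0.
have H : \forall s \near t, forall j, `|u j t - u j s| <= eps / L.
  have nbhs_t j : nbhs t (fun s => `|u j t - u j s| <= eps / L).
    by have /cvgrPdist_le/(_ _ e0) := cu j t.
  exact: (filter_forall (nbhs_filter t) nbhs_t).
apply: filterS H => s H; apply: (le_trans (FL H i)).
by rewrite mulrC divfK ?gt_eqF.
Qed.

Definition picard_step (u : I -> R -> R) (i : I) (t : R) : R :=
  x i + ray_primitive (fun s => F (u^~ s) i) t.

Let continuous_step (u : I -> R -> R) :
  (forall j, continuous (u j)) -> forall i, continuous (picard_step u i).
Proof.
move=> cu i t.
have cprim : {for t, continuous (ray_primitive (fun s => F (u^~ s) i))}.
  by apply: continuous_ray_primitive; exact: continuous_field.
exact: (cvgD (cvg_cst (x i)) cprim).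
Qed.

Let step_contraction (u v : I -> R -> R) (c : R) :
  (forall j, continuous (u j)) -> (forall j, continuous (v j)) ->
  (forall j t, `|u j t - v j t| <= c * w t) ->
  forall i t, `|picard_step u i t - picard_step v i t| <= c * 2^-1 * w t.
Proof.
move=> cu cv uv i t; rewrite /picard_step opprD addrACA subrr add0r.
rewrite ray_primitive_max [X in _ - X]ray_primitive_max.
have m0 : 0 <= Num.max t 0 by rewrite le_max lexx orbT.
have -> : c * 2^-1 = L * c / (2 * L) by field; rewrite gt_eqF.
pose h s := ray_primitive (fun s => F (u^~ s) i) s -
            ray_primitive (fun s => F (v^~ s) i) s.
apply: (@expR_weighted_bound _ h (fun s => F (u^~ s) i - F (v^~ s) i)) => //.
- by rewrite /h !ray_primitive0 subrr.
- move=> s s0; apply: ray_derivativeB; apply: ray_derivative_primitive => //.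
  + exact: continuous_field.
  + exact: continuous_field.
- move=> s s0; rewrite -mulrA; apply: FL => j.
  by have := uv j s; rewrite /w (max_idPl s0).
Qed.

Let picard (k : nat) : I -> R -> R := iter k picard_step (fun i _ => x i).

Let continuous_picard k j : continuous (picard k j).
Proof.
elim: k j => [|k IH] j; last exact: continuous_step.
by move=> t; exact: cvg_cst.
Qed.

(* The first increment [picard 1 - picard 0] has the constant derivative [F x],
   which the weight dominates. *)
Let C : R := (\sum_j `|F x j|) / (2 * L).

Let C0 : 0 <= C.
Proof. by rewrite divr_ge0 ?sumr_ge0// ltW. Qed.

Let w0 t : 0 <= w t. Proof. exact: expR_ge0. Qed.

Let picard_increment k j t :
  `|picard k.+1 j t - picard k j t| <= C * 2^-1 ^+ k * w t.
Proof.
elim: k j t => [|k IH] j t; last first.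
  rewrite exprSr mulrA.
  apply: (@step_contraction (picard k.+1) (picard k)) => // i;
    exact: continuous_picard.
rewrite expr0 mulr1 /= /picard_step addrAC subrr add0r ray_primitive_max.
have cx : continuous (fun s : R => F (fun i => x i) j).
  by move=> s; exact: cvg_cst.
apply: (expR_weighted_bound L20 (ray_primitive0 _)).
- by move=> s s0; apply: ray_derivative_primitive.
- move=> s s0; have e1 : 1 <= expR (2 * L * s).
    by rewrite -[leLHS]expR0 ler_expR mulr_ge0// ltW.
  rewrite -[leLHS]mulr1 ler_pM//.
  by rewrite (bigD1 j)//= lerDl sumr_ge0.
- by rewrite le_max lexx orbT.
Qed.

(* Summing the geometric series of the increments; the induction carries the
   exact partial sum [2 (1 - 2^-m)]. *)
Let picard_dist k m j t :
  `|picard (k + m) j t - picard k j t| <= 2 * C * 2^-1 ^+ k * w t.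
Proof.
have half0 q : 0 <= 2^-1 ^+ q :> R by rewrite exprn_ge0// invr_ge0.
apply: (@le_trans _ _ (2 * C * 2^-1 ^+ k * (1 - 2^-1 ^+ m) * w t)); last first.
  apply: ler_wpM2r => //; apply: ler_piMr; last by rewrite gerBl.
  by apply: mulr_ge0 (half0 k); exact: mulr_ge0 (ler0n _ 2) C0.
elim: m => [|m IH]; first by rewrite addn0 !subrr normr0 mulr0 mul0r.
rewrite addnS -(subrK (picard (k + m) j t) (picard _ j t)) -addrA.
apply: (le_trans (ler_normD _ _)).
apply: (le_trans (lerD (picard_increment _ _ _) IH)).
rewrite exprD exprS le_eqVlt; apply/orP; left; apply/eqP.
by field.
Qed.

Let small_geometric (c eps : R) : 0 < eps -> exists k, c * 2^-1 ^+ k < eps.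
Proof.
move=> eps0; apply: contrapT => /forallNP H.
have : eps <= 0; last by rewrite leNgt eps0.
apply: (@geometric_le0 _ _ c) => k; rewrite leNgt; exact/negP/H.
Qed.

Let is_cvg_picard j t : cvgn (fun k => picard k j t).
Proof.
apply: cauchy_cvg; apply: cauchy_exP => eps eps0.
have [k hk] := small_geometric (2 * C * w t) eps0.
exists (picard k j t); rewrite nbhs_simpl/=; exists k => // m /= km.
rewrite /ball/= distrC -(subnKC km).
by apply: le_lt_trans hk; rewrite mulrAC; exact: picard_dist.
Qed.

Let u (j : I) (t : R) : R := limn (fun k => picard k j t).

Let picard_limit_dist k j t :
  `|u j t - picard k j t| <= 2 * C * 2^-1 ^+ k * w t.
Proof.
have H : `|picard m j t - picard k j t| @[m --> \oo] -->
    `|u j t - picard k j t|.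
  apply: cvg_norm; apply: cvgB; [exact: is_cvg_picard|exact: cvg_cst].
rewrite -(cvg_lim (@Rhausdorff R) H); apply: limr_le; first exact: (cvgP _ H).
by exists k => // m /= km; rewrite -(subnKC km).
Qed.

(* The convergence is uniform only where the weight is bounded, which is the case
   near [t] since the weight is continuous. *)
Let continuous_limit j : continuous (u j).
Proof.
move=> t; apply/cvgrPdist_le => eps eps0.
have e40 : 0 < eps / 4 by rewrite divr_gt0.
have [k hk] := small_geometric (2 * C * (w t + 1)) e40.
have cw : {for t, continuous w}.
  have cmax : {for t, continuous (fun s : R => Num.max s 0)}.
    by apply: (@continuous_max _ _ id (cst 0)); [exact: cvg_id|exact: cvg_cst].
  have cexp : {for Num.max t 0, continuous (fun s => expR (2 * L * s))}.
    apply: (@continuous_comp _ _ _ (fun s => 2 * L * s));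
      last exact: continuous_expR.
    exact: (cvgM (cvg_cst _) cvg_id).
  exact: (continuous_comp cmax cexp).
have /cvgrPdist_le/(_ _ ltr01) wt := cw.
have cp : {for t, continuous (picard k j)} by exact: continuous_picard.
have /cvgrPdist_le/(_ _ e40) pt := cp.
apply: filterS2 wt pt => s wt pt.
have C2 : 0 <= 2 * C * 2^-1 ^+ k.
  apply: mulr_ge0; first exact: mulr_ge0 (ler0n _ 2) C0.
  by rewrite exprn_ge0// invr_ge0.
have small r : w r <= w t + 1 -> `|u j r - picard k j r| <= eps / 4.
  move=> wr; apply: le_trans (ltW hk).
  apply: (le_trans (picard_limit_dist k j r)).
  by rewrite [leRHS]mulrAC ler_wpM2l.
have ws : w s <= w t + 1 by move: wt; rewrite ler_norml => /andP[]; lra.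
have wtt : w t <= w t + 1 by rewrite lerDl.
move: (small s ws) (small t wtt) pt.
rewrite !ler_norml => /andP[? ?] /andP[? ?] /andP[? ?].
by apply/andP; split; lra.
Qed.

(* Both [picard_step u] and [u] are within a geometrically small distance of
   [picard k.+1]: the former by contraction, the latter by convergence. *)
Let limit_fixed i t : picard_step u i t = u i t.
Proof.
apply/eqP; rewrite -subr_eq0 -normr_le0.
apply: (@geometric_le0 _ _ (2 * C * w t)) => k.
rewrite -(subrK (picard k.+1 i t) (picard_step u i t)) -addrA.
apply: (le_trans (ler_normD _ _)).
have A := step_contraction continuous_limit (@continuous_picard k)
  (picard_limit_dist k) i t.
have B := picard_limit_dist k.+1 i t; rewrite distrC in B.
apply: (le_trans (lerD A B)); rewrite exprS le_eqVlt.
apply/orP; left; apply/eqP.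
by field.
Qed.

(** A fixed point of [picard_step] is a solution, because the integrand is
    continuous and has the value of the field at each time [t >= 0]. *)
Theorem picard_lindelof : exists u : I -> R -> R,
  (forall i, u i 0 = x i) /\
  forall i t, 0 <= t -> ray_derivative (u i) t (F (u^~ t) i).
Proof.
exists u; split=> [i|i t t0].
  by rewrite -limit_fixed /picard_step ray_primitive0 addr0.
have cF : continuous (fun s => F (u^~ s) i) by exact: continuous_field.
have := ray_derivative_primitive cF t0.
have -> : u i = picard_step u i by apply/funext => s; rewrite limit_fixed.
rewrite /picard_step /ray_derivative.
by under [in X in _ -> X]eq_fun do rewrite opprD addrACA subrr add0r.
Qed.

End picard.

(** * The Kuramoto vector field *)

Lemma sin_lipschitz (R : realType) (a b : R) : `|sin a - sin b| <= `|a - b|.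
Proof.
wlog ab : a b / a < b => [H|].
  have [/H //|/H|->] := ltgtP a b; last by rewrite !subrr.
  by rewrite distrC [leRHS]distrC.
have dsin (y : R) : y \in `]a, b[ -> is_derive y 1 sin (cos y).
  by move=> _; exact: is_derive_sin.
have csin : {within `[a, b], continuous (@sin R)}.
  by apply: continuous_subspaceT; exact: continuous_sin.
have [c _ sinE] := MVT ab dsin csin.
rewrite distrC sinE normrM [leRHS]distrC ler_piMl//.
by rewrite ler_norml cos_geN1 cos_le1.
Qed.

Definition kuramoto_field (R : realType) (n : nat) (e : rel 'I_n) (alpha : R)
    (u : 'I_n -> R) (i : 'I_n) : R :=
  \sum_(j < n) adjacency R e i j * sin (u j - u i - alpha).

Lemma kuramoto_field_bounded (R : realType) (n : nat) (e : rel 'I_n)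
    (alpha : R) (u : 'I_n -> R) (i : 'I_n) :
  `|kuramoto_field e alpha u i| <= n%:R.
Proof.
apply: (le_trans (ler_norm_sum _ _ _)).
rewrite -[X in X%:R]card_ord -sumr_const; apply: ler_sum => j _.
rewrite normrM mxE; apply: mulr_ile1 => //.
  by case: (e i j); rewrite ?normr1 ?normr0.
by rewrite ler_norml sin_geN1 sin_le1.
Qed.

Lemma kuramoto_field_lipschitz (R : realType) (n : nat) (e : rel 'I_n)
    (alpha : R) : sup_lipschitz (@kuramoto_field R n e alpha) (2 * n%:R + 1).
Proof.
move=> u v d uv i; have d0 : 0 <= d by apply: le_trans (uv i).
apply: (@le_trans _ _ (n%:R * (2 * d))); last by nra.
rewrite /kuramoto_field -sumrB; apply: (le_trans (ler_norm_sum _ _ _)).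
rewrite -[X in X%:R]card_ord mulr_natl -sumr_const; apply: ler_sum => j _.
rewrite -mulrBr normrM mxE -[leRHS]mul1r; apply: ler_pM => //.
  by case: (e i j); rewrite ?normr1 ?normr0.
apply: (le_trans (sin_lipschitz _ _)); move: (uv i) (uv j).
by rewrite !ler_norml => /andP[? ?] /andP[? ?]; apply/andP; split; lra.
Qed.

(** * Representatives of the parts of a partition *)

Section representative.
Variables (T : finType) (S : {set {set T}}).
Hypothesis partS : finset.partition S [set: T]%SET.

(** The block is the same set for all members of a part and [pick] depends only
    on that set, so all members get the same representative.  For a partition
    the default [i] is never reached, since the block of [i] contains [i]. *)
Definition part_repr (i : T) : T :=
  odflt i [pick j in finset.pblock S i].

Let trivS : finset.trivIset S. Proof. by case/and3P: partS. Qed.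

Let coverS (i : T) : i \in finset.cover S.
Proof. by case/and3P: partS => /eqP -> _ _; rewrite inE. Qed.

Lemma part_repr_in (P : {set T}) (i : T) :
  P \in S -> i \in P -> part_repr i \in P.
Proof.
move=> PS iP; rewrite /part_repr (finset.def_pblock trivS PS iP).
by case: pickP => [//|/(_ i)]; rewrite iP.
Qed.

Lemma part_repr_eq (P : {set T}) (i j : T) :
  P \in S -> i \in P -> j \in P -> part_repr i = part_repr j.
Proof.
move=> PS iP jP; rewrite /part_repr (finset.def_pblock trivS PS iP).
rewrite (finset.def_pblock trivS PS jP).
by case: pickP => [//|/(_ i)]; rewrite iP.
Qed.

Lemma part_of (i : T) : exists2 P : {set T}, P \in S & i \in P.
Proof.
exists (finset.pblock S i); first exact: finset.pblock_mem.
by rewrite finset.mem_pblock.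
Qed.

Lemma part_repr_inj (P Q : {set T}) (i j : T) :
  P \in S -> Q \in S -> i \in P -> j \in Q ->
  part_repr i = part_repr j -> P = Q.
Proof.
move=> PS QS iP jQ ij.
rewrite -(finset.def_pblock trivS PS (part_repr_in PS iP)) ij.
exact: finset.def_pblock trivS QS (part_repr_in QS jQ).
Qed.

Lemma part_repr_fiber (i : T) :
  exists2 Q : {set T}, Q \in S &
    forall j, (part_repr j == part_repr i) = (j \in Q).
Proof.
have [Q QS iQ] := part_of i; exists Q => // j.
apply/eqP/idP => [ji|jQ]; last exact: part_repr_eq QS _ _.
have [P PS jP] := part_of j.
by rewrite -(part_repr_inj PS QS jP iQ ji).
Qed.

End representative.

(** * Synchronised parts stay synchronised *)

(** Grouping the neighbours of a vertex by the representative of their part turns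
    the force into a sum over parts, in which the vertex enters only through its
    own phase and its number of neighbours in each part.  Both are constant on
    parts. *)
Lemma kuramoto_field_equitable (R : realType) (n : nat) (e : rel 'I_n)
    (S : {set {set 'I_n}}) (alpha : R) (u : 'I_n -> R) (i : 'I_n) :
  equitable_partition e S ->
  let v j := u (part_repr S j) in
  kuramoto_field e alpha v i = kuramoto_field e alpha v (part_repr S i).
Proof.
move=> [partS eqS] v.
have [P PS iP] := part_of partS i.
have rP := part_repr_in partS PS iP.
have vi : v (part_repr S i) = v i by rewrite /v (part_repr_eq partS PS rP iP).
rewrite /kuramoto_field vi.
pose r := part_repr S.
have degree k k' : \sum_(j | r j == k') adjacency R e k j =
    #|[set j in [set j | r j == k'] | e k j]%SET|%:R.
  rewrite -sum1dep_card natr_sum [RHS]big_mkcond [LHS]big_mkcond /=.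
  by apply: eq_bigr => j _; rewrite !inE mxE; case: eqP => //=; case: (e k j).
have by_part k : \sum_(j < n) adjacency R e k j * sin (v j - v i - alpha) =
    \sum_k' #|[set j in [set j | r j == k'] | e k j]%SET|%:R *
      sin (u k' - v i - alpha).
  rewrite (partition_big r xpredT)//=; apply: eq_bigr => k' _.
  by rewrite -degree mulr_suml; apply: eq_bigr => j /eqP <-.
rewrite !by_part; apply: eq_bigr => k _; congr (_%:R * _).
(* Fibres of [r] are parts of [S], or empty when [k] represents no part. *)
have [[j rj]|none] := pselect (exists j, r j = k).
  have [Q QS QE] := part_repr_fiber partS j.
  have -> : [set l | r l == k]%SET = Q by apply/setP => l; rewrite inE -QE -rj.
  exact: eqS PS QS _ _ iP rP.
have -> : [set l | r l == k]%SET = finset.set0.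
  apply/setP => l; rewrite !inE; apply/negbTE/eqP => rl.
  by apply: none; exists l.
by congr #|pred_of_set _|; apply/setP => l; rewrite !inE.
Qed.

(** The index of the representative serves as the common initial phase of a part:
    any injective labelling of the parts would do. *)
Theorem theorem5 (R : realType) (n : nat) (e : rel 'I_n)
    (S : {set {set 'I_n}}) :
  simple_graph e -> connected_graph e -> equitable_partition e S ->
  forall alpha : R, 0 < alpha < pi / 2 -> kuramoto_partition e alpha S.
Proof.
move=> _ _ eqS alpha _; have partS := eqS.1; split=> //.
pose r := part_repr S; pose L : R := 2 * n%:R + 1.
have L0 : 0 < L by rewrite ltr_wpDl// mulr_ge0.
have FL := @kuramoto_field_lipschitz R n e alpha.
exists (fun i => (r i : nat)%:R); split.
  have [u [u0 du]] := picard_lindelof L0 FL (fun i => (r i : nat)%:R).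
  by exists u; split.
move=> theta [theta0 dtheta].
split=> [P PS i j iP jP t t0|P Q PS QS PQ i j iP jQ]; last first.
  move=> /(_ 0 (lexx _)); rewrite !theta0 => /eqP.
  rewrite eqr_nat => /eqP/val_inj rij.
  exact/PQ/(part_repr_inj partS PS QS iP jQ).
have rr k : r (r k) = r k.
  have [Q QS kQ] := part_of partS k.
  exact: (part_repr_eq partS QS (part_repr_in partS QS kQ) kQ).
pose F := kuramoto_field e alpha.
have sync k : theta k t - theta (r k) t = 0.
  apply: (@linear_bound_eq0 _ _ (fun k s => theta k s - theta (r k) s)
    (fun k s => F (theta^~ s) k - F (theta^~ s) (r k))
    (2 * L) (2 * n%:R)) => //.
  - by rewrite mulr_gt0.
  - by move=> l; rewrite !theta0 rr subrr.
  - by move=> l s s0; apply: ray_derivativeB; exact: dtheta.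
  - move=> l s s0; apply: (le_trans (ler_normB _ _)).
    by rewrite mulr_natl mulr2n lerD// kuramoto_field_bounded.
  - move=> s d s0 hd l.
    (* [v] moves every phase to that of its representative; the field agrees at
       [l] and [r l] there, and each phase moves by at most [d]. *)
    pose v m := theta (r m) s.
    have Fv : F v l = F v (r l).
      exact: (kuramoto_field_equitable alpha (theta^~ s) l eqS).
    have Fd m : `|F (theta^~ s) m - F v m| <= L * d by exact: FL.
    rewrite (_ : _ - _ = (F (theta^~ s) l - F v l) -
      (F (theta^~ s) (r l) - F v (r l))); last by rewrite Fv; ring.
    apply: (le_trans (ler_normB _ _)).
    apply: (le_trans (lerD (Fd l) (Fd (r l)))).
    by rewrite -mulrA mulr_natl mulr2n.
move/eqP: (sync i); move/eqP: (sync j); rewrite !subr_eq0 => /eqP -> /eqP ->.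
by rewrite /r (part_repr_eq partS PS iP jP).
Qed.
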